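(* Let $J:=\operatorname{conv}\{\mathbf{v}_0,\mathbf{v}_1,\dots,\mathbf{v}_d\}\subset\mathbb{R}^d_{\ge0}\setminus\{\mathbf{0}\}$ be a $d$-simplex, $\mathbf{c}\in\mathbb{R}^d$, and $f(\mathbf{x}):=e^{\mathbf{c}^\top\mathbf{x}}-1$, and suppose $\mathbf{c}^\top\mathbf{v}_0-\mathbf{c}^\top\mathbf{v}_j=u\neq0$ for $j=1,\dots,d$. Then $$\operatorname{vol}(P(f,J))=\frac{d!\operatorname{vol}(J)}{(d+2)!}\bigl(e^{\mathbf{c}^\top\mathbf{v}_0}+de^{\mathbf{c}^\top\mathbf{v}_0-u}\bigr)-\frac{d!\operatorname{vol}(J)}{d+2}\cdot\frac{e^{\mathbf{c}^\top\mathbf{v}_0-u}}{u^d}\left(e^u-\sum_{j=0}^{d-1}\frac{u^j}{j!}\right),$$ and $$\begin{aligned}\operatorname{vol}(P^0(f,J))=&\ \frac{d!\operatorname{vol}(J)}{(d+2)!}\bigl(e^{\mathbf{c}^\top\mathbf{v}_0}+de^{\mathbf{c}^\top\mathbf{v}_0-u}+1\bigr)-d!\operatorname{vol}(J)\frac{e^{\mathbf{c}^\top\mathbf{v}_0-u}}{(\mathbf{c}^\top\mathbf{v}_0)u^d}\left(e^u-\sum_{j=0}^{d-1}\frac{u^j}{j!}\right)\\&+d!\operatorname{vol}(J)\frac{e^{\mathbf{c}^\top\mathbf{v}_0-u}}{(\mathbf{c}^\top\mathbf{v}_0)\,[-(\mathbf{c}^\top\mathbf{v}_0-u)]^d}\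left(e^{-(\mathbf{c}^\top\mathbf{v}_0-u)}-\sum_{j=0}^{d-1}\frac{[-(\mathbf{c}^\top\mathbf{v}_0-u)]^j}{j!}\right).\end{aligned}$$
   Context: $\operatorname{vol}(J)$ is the $d$-dimensional Lebesgue measure of $J$, and $\operatorname{vol}$ of the relaxations is $(d+2)$-dimensional Lebesgue measure. Let $\mu$ be the unique affine function agreeing with $f$ at the vertices of $J$ and $\mu(\mathbf{x},z):=z\mu(\mathbf{x}/z)$ (extended linearly in $(\mathbf{x},z)$). For $z\ge0$, $z\cdot J:=\{z\mathbf{x}:\mathbf{x}\in J\}$. Perspective relaxation: $P(f,J):=\operatorname{cl}\{(\mathbf{x},y,z)\in\mathbb{R}^d\times\mathbb{R}\times\mathbb{R}:\mu(\mathbf{x},z)\ge y\ge zf(\mathbf{x}/z),\ \mathbf{x}\in z\cdot J,\ 1\ge z>0\}$. Naive relaxation: $P^0(f,J):=\{(\mathbf{x},y,z)\in\mathbb{R}^d\times\mathbb{R}\times\mathbb{R}:\mu(\mathbf{x},z)\ge y\ge f(\mathbf{x}),\ \mathbf{x}\in z\cdot J,\ 1\ge z\ge0\}$.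
   Formalization: The formula for vol(P^0(f,J)) is proved under the added assumptions c^T v_0 ≠ 0 and c^T v_0 − u ≠ 0, since it divides by c^T v_0 and by [−(c^T v_0 − u)]^d, which the stated hypotheses allow to vanish. *)

(* Defs.v *)
From HB Require Import structures.
From mathcomp Require Import all_boot all_order all_algebra.
From mathcomp Require Import all_classical all_reals all_analysis.
Set Implicit Arguments. Unset Strict Implicit. Unset Printing Implicit Defensive.
Import Order.TTheory GRing.Theory Num.Theory.
Import numFieldNormedType.Exports.
Local Open Scope classical_set_scope.
Local Open Scope ring_scope.

Section Defs.
Variable R : realType.

Definition vcons (n : nat) (t : R) (v : 'rV[R]_n) : 'rV[R]_n.+1 :=
  \row_(i < n.+1) (if unlift ord0 i is Some j then v ord0 j else t).

Fixpoint iint (n : nat) : ('rV[R]_n -> \bar R) -> \bar R :=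
  match n with
  | 0 => fun F => F 0
  | n'.+1 => fun F =>
      (\int[@lebesgue_measure R]_(t in setT)
          iint (fun v : 'rV[R]_n' => F (vcons t v)))%E
  end.

(* n-dimensional Lebesgue measure of A (via Tonelli, as iterated integrals) *)
Definition vol (n : nat) (A : set 'rV[R]_n) : \bar R :=
  iint (fun x => (\1_A x)%:E).

Definition vol3 (d : nat) (S : set ('rV[R]_d * R * R)) : \bar R :=
  iint (fun x : 'rV[R]_d =>
    (\int[@lebesgue_measure R]_(y in setT)
       \int[@lebesgue_measure R]_(z in setT) (\1_S (x, y, z))%:E)%E).

Definition dotr (d : nat) (c x : 'rV[R]_d) : R := \sum_(i < d) c ord0 i * x ord0 i.

Definition aff_indep (d : nat) (v : 'I_d.+1 -> 'rV[R]_d) : Prop :=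
  forall lam : 'I_d.+1 -> R,
    \sum_(i < d.+1) lam i = 0 -> \sum_(i < d.+1) lam i *: v i = 0 ->
    forall i, lam i = 0.

Definition conv_hull (d : nat) (v : 'I_d.+1 -> 'rV[R]_d) : set 'rV[R]_d :=
  [set x | exists lam : 'I_d.+1 -> R,
     (forall i, 0 <= lam i) /\ \sum_(i < d.+1) lam i = 1 /\
     x = \sum_(i < d.+1) lam i *: v i].

Definition scale_set (d : nat) (z : R) (J : set 'rV[R]_d) : set 'rV[R]_d :=
  [set z *: w | w in J].

(* the perspective relaxation P(f, J); mu is given by (a, b), mu(x) = a^T x + b,
   so mu(x, z) = a^T x + b z *)
Definition persp_relax (d : nat) (f : 'rV[R]_d -> R) (a : 'rV[R]_d) (b : R)
    (J : set 'rV[R]_d) : set ('rV[R]_d * R * R) :=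
  closure [set p | let: (x, y, z) := p in
    dotr a x + b * z >= y /\ y >= z * f (z^-1 *: x) /\
    scale_set z J x /\ 0 < z <= 1].

Definition naive_relax (d : nat) (f : 'rV[R]_d -> R) (a : 'rV[R]_d) (b : R)
    (J : set 'rV[R]_d) : set ('rV[R]_d * R * R) :=
  [set p | let: (x, y, z) := p in
    dotr a x + b * z >= y /\ y >= f x /\
    scale_set z J x /\ 0 <= z <= 1].

End Defs.

(* Main.v *)
(* Write [x = z v_0 + sum_j lam_j (v_j - v_0)] with [j >= 1].  For [z > 0],
   [x] lies in [z J] iff [lam >= 0] and [s := sum_j lam_j <= z], and by the
   hypothesis on [c] everything depends on [(z, s)] alone:
   [c.x = z c.v_0 - u s] and [mu(x, z) = z (e^(c.v_0) - 1) - U s], where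
   [U = e^(c.v_0) - e^(c.v_0 - u)].  Integrating out [y] and changing variables
   linearly (only the existence of the Jacobian [K] matters, since
   [vol J = K / d!]), both volumes become
     [K int_0^1 int_0^z (mu - lower bound)(z, s) s^(d-1) / (d-1)! ds dz],
   which has an explicit primitive.  The slice [z = 0], hence also the points
   added by the closure, is null for the innermost integral.  Convexity of the
   exponential shows that the lower bound does not exceed [mu]. *)
Require Import Defs.
From HB Require Import structures.
From mathcomp Require Import all_boot all_order all_algebra.
From mathcomp Require Import all_classical all_reals all_analysis.
From mathcomp Require Import measurable_realfun ring lra.
Set Implicit Arguments. Unset Strict Implicit. Unset Printing Implicit Defensive.
Import Order.TTheory GRing.Theory Num.Theory.
Import numFieldNormedType.Exports.
Local Open Scope classical_set_scope.
Local Open Scope ring_scope.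

(** * Measurability and Tonelli for iterated integrals *)

(** Opaque, so that this display is not convertible to the default one. *)
Fact rV_display : measure_display. Proof. exact: default_measure_display. Qed.

Section measurable_rV.
Variables (R : realType) (n : nat).

Let coors (i : 'I_n) (v : 'rV[R]_n) : measurableTypeR R := v ord0 i.

Let rV_set0 : g_sigma_preimage coors set0.
Proof. exact: sigma_algebra0. Qed.

Let rV_setC A : g_sigma_preimage coors A -> g_sigma_preimage coors (~` A).
Proof. exact: sigma_algebraC. Qed.

Let rV_bigcup (F : (set 'rV[R]_n)^nat) : (forall i, g_sigma_preimage coors (F i)) ->
  g_sigma_preimage coors (\bigcup_i (F i)).
Proof. exact: sigma_algebra_bigcup. Qed.

(** The product sigma-algebra, generated by the coordinates, so that measurability of a map into row
    vectors can be tested on each coordinate. *)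
HB.instance Definition _ := @isMeasurable.Build rV_display
  'rV[R]_n (g_sigma_preimage coors) rV_set0 rV_setC rV_bigcup.

Lemma measurable_coord (i : 'I_n) :
  measurable_fun [set: 'rV[R]_n] (fun v => v ord0 i).
Proof.
move=> _ Y mY; rewrite setTI; apply: sub_sigma_algebra => /=.
rewrite -bigcup_seq/=; exists i => /=; first by rewrite mem_index_enum.
by exists Y => //; rewrite setTI.
Qed.

Lemma measurable_fun_rVP d (T : measurableType d) (f : T -> 'rV[R]_n) :
  measurable_fun setT f <-> forall i, measurable_fun setT (fun t => f t ord0 i).
Proof.
split=> [mf i|mf].
  exact: (measurableT_comp (measurable_coord i) mf).
move=> _ Y mY; rewrite setTI.
(* Preimages commute with the generation of sigma-algebras, which leaves only the sets cut out by a
   single coordinate of [f]. *)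
have : g_sigma_preimage (fun i => coors i \o f) (f @^-1` Y).
  rewrite g_sigma_preimage_comp; exists Y => //; by rewrite setTI.
move: (f @^-1` Y); apply: smallest_sub; first exact: sigma_algebra_measurable.
elim/big_ind : _ => [A //|A B hA hB C [/hA|/hB]//|i _ A [B mB <-]].
by have := mf i measurableT B mB; rewrite !setTI.
Qed.

End measurable_rV.

Section iint_theory.
Variable R : realType.
Local Notation mu := (@lebesgue_measure R).

(** Generalises [vcons], which is convertible to the case [i = ord0], to insertion at the position
    of an arbitrary pivot. *)
Definition vins n (i : 'I_n.+1) (t : R) (v : 'rV[R]_n) : 'rV[R]_n.+1 :=
  \row_(j < n.+1) (if unlift i j is Some k then v ord0 k else t).

Lemma measurable_vins d (T : measurableType d) n (i : 'I_n.+1) (f : T -> R)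
    (g : T -> 'rV[R]_n) :
  measurable_fun setT f -> measurable_fun setT g ->
  measurable_fun setT (fun t => vins i (f t) (g t)).
Proof.
move=> mf mg; apply/measurable_fun_rVP => j.
under eq_fun do rewrite mxE.
case: (unlift i j) => [k|//].
by move/measurable_fun_rVP : mg => /(_ k).
Qed.

Lemma measurable_vcons d (T : measurableType d) n (f : T -> R)
    (g : T -> 'rV[R]_n) :
  measurable_fun setT f -> measurable_fun setT g ->
  measurable_fun setT (fun t => vcons (f t) (g t)).
Proof. exact: measurable_vins. Qed.

Local Open Scope ereal_scope.

Lemma iint_ge0 n (F : 'rV[R]_n -> \bar R) : (forall v, 0 <= F v) -> 0 <= iint F.
Proof.
elim: n F => [|n IH] F F0 /=; first exact: F0.
by apply: integral_ge0 => t _; exact: IH.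
Qed.

Lemma eq_iint n (F G : 'rV[R]_n -> \bar R) : F =1 G -> iint F = iint G.
Proof. by move=> /funext ->. Qed.

(** The parameter space [T] is arbitrary so that the induction can absorb one coordinate at a time
    into it. *)
Lemma measurable_iint n d (T : measurableType d) (F : T * 'rV[R]_n -> \bar R) :
  measurable_fun setT F -> (forall x, 0 <= F x) ->
  measurable_fun setT (fun t => iint (fun v => F (t, v))).
Proof.
elim: n d T F => [|n IH] d T F mF F0 /=.
  by apply: (measurableT_comp mF); exact: measurable_pair2.
pose G (x : (T * measurableTypeR R) * 'rV[R]_n) := F (x.1.1, vcons x.1.2 x.2).
have mG : measurable_fun setT G.
  apply: (measurableT_comp mF); apply: measurable_fun_pair => /=.
    exact: (measurableT_comp measurable_fst measurable_fst).
  by apply: measurable_vcons => //; exact: (measurableT_comp measurable_snd measurable_fst).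
have := IH _ _ G mG (fun x => F0 _).
move=> /(measurable_fun_fubini_tonelli_F (m2 := mu)); apply.
by move=> x; apply: iint_ge0 => v; exact: F0.
Qed.

(** Two-variable Tonelli moves [m] past the first coordinate; with that coordinate fixed, induction
    moves it past the others. *)
Lemma integral_iint n d (T : measurableType d)
    (m : {sigma_finite_measure set T -> \bar R}) (F : T * 'rV[R]_n -> \bar R) :
  measurable_fun setT F -> (forall x, 0 <= F x) ->
  \int[m]_t iint (fun v => F (t, v)) = iint (fun v => \int[m]_t F (t, v)).
Proof.
elim: n d T m F => [|n IH] d T m F mF F0 //=.
pose G (x : (T * measurableTypeR R) * 'rV[R]_n) := F (x.1.1, vcons x.1.2 x.2).
have mG : measurable_fun setT G.
  apply: (measurableT_comp mF); apply: measurable_fun_pair => /=.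
    exact: (measurableT_comp measurable_fst measurable_fst).
  by apply: measurable_vcons => //; exact: (measurableT_comp measurable_snd measurable_fst).
transitivity (\int[m]_t \int[mu]_s iint (fun v => G ((t, s), v))) => //.
rewrite (fubini_tonelli (fun x => iint (fun v => G (x, v)))); last 2 first.
- exact: (measurable_iint mG (fun x => F0 _)).
- by move=> x; apply: iint_ge0 => v; exact: F0.
apply: eq_integral => s _ /=.
rewrite (IH _ _ m (fun x => F (x.1, vcons s x.2)))//.
apply: (measurableT_comp mF); apply: measurable_fun_pair => //=.
exact: measurable_vcons.
Qed.

End iint_theory.

(** * Changes of variables *)

Section affine_substitution.
Variable R : realType.
Local Notation mu := (@lebesgue_measure R).
Local Open Scope ereal_scope.

Lemma measurable_affine (a b : R) :
  measurable_fun setT ((fun t => a * t + b)%R : R -> measurableTypeR R).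
Proof. by apply: measurable_funD => //; exact: measurable_funM. Qed.

Definition affine_pushforward (a b : R) :
    {measure set (measurableTypeR R) -> \bar R} :=
  measure_function_pushforward__canonical__measure_function_Measure
    mu (measurable_affine a b).

(** By uniqueness of Lebesgue measure, it suffices to compare both sides on half-open intervals. *)
Lemma lebesgue_measure_affine (a b : R) (A : set R) : a != 0%R -> measurable A ->
  mu A = `|a|%:E * pushforward mu
    ((fun t => a * t + b)%R : R -> measurableTypeR R) A.
Proof.
move=> a0 mA.
pose nu := mscale (NngNum (normr_ge0 a)) (affine_pushforward a b).
suff : mu A = nu A by [].
apply: lebesgue_measure_unique => //= _ [[x y]] _ <-.
rewrite /nu/= /mscale/= /pushforward/=.
have [agt|alt|a00] := ltgtP 0%R a; last by rewrite -a00 eqxx in a0.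
- have -> : (fun t => a * t + b)%R @^-1` `]x, y]%classic =
     `](x - b) / a, (y - b) / a]%classic%R.
    apply/seteqP; split => t; rewrite /= !in_itv/= ltr_pdivrMr// ler_pdivlMr//.
      by rewrite (mulrC t) ltrBlDr lerBrDr.
    by rewrite (mulrC t) ltrBlDr lerBrDr.
  rewrite !lebesgue_measure_itv/= !lte_fin gtr0_norm//.
  rewrite ltr_pM2r ?invr_gt0// ltrD2r; case: ifP => _; last by rewrite mule0.
  by rewrite -!EFinD -EFinM; congr EFin; field.
(* For [a < 0] the endpoints swap and the preimage is half-open on the other side, which does not
   change its measure. *)
- have -> : (fun t => a * t + b)%R @^-1` `]x, y]%classic =
     `[(y - b) / a, (x - b) / a[%classic%R.
    apply/seteqP; split => t; rewrite /= !in_itv/= ltr_ndivlMr// ler_ndivrMr//.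
      by rewrite (mulrC t) ltrBlDr lerBrDr andbC.
    by rewrite (mulrC t) ltrBlDr lerBrDr andbC.
  rewrite !lebesgue_measure_itv/= !lte_fin ltr0_norm//.
  rewrite ltr_nM2r ?invr_lt0// ltrD2r; case: ifP => _; last by rewrite mule0.
  by rewrite -!EFinD -EFinM; congr EFin; field.
Qed.

Lemma ge0_integral_affine (a b : R) (F : R -> \bar R) : a != 0%R ->
  measurable_fun setT F -> (forall t, 0 <= F t) ->
  \int[mu]_t F t = `|a|%:E * \int[mu]_t F (a * t + b)%R.
Proof.
move=> a0 mF F0.
pose nu := mscale (NngNum (normr_ge0 a)) (affine_pushforward a b).
transitivity (\int[nu]_t F t).
  by apply: eq_measure_integral => //= A mA _; exact: lebesgue_measure_affine.
rewrite /nu ge0_integral_mscale//; congr (_ * _).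
by rewrite ge0_integral_pushforward//; exact: measurable_affine.
Qed.

End affine_substitution.

Section iint_change_of_variables.
Variable R : realType.
Local Notation mu := (@lebesgue_measure R).
Local Open Scope ereal_scope.

Lemma measurable_comp_vcons n d (T : measurableType d) (F : 'rV[R]_n.+1 -> \bar R)
    (f : T -> R) (g : T -> 'rV[R]_n) :
  measurable_fun setT F -> measurable_fun setT f -> measurable_fun setT g ->
  measurable_fun setT (fun t => F (vcons (f t) (g t))).
Proof.
by move=> mF mf mg; apply: (measurableT_comp mF); exact: measurable_vcons.
Qed.

Lemma measurable_iint_vcons n (F : 'rV[R]_n.+1 -> \bar R) :
  measurable_fun setT F -> (forall v, 0 <= F v) ->
  measurable_fun setT (fun t : R => iint (fun v => F (vcons t v))).
Proof.
move=> mF F0.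
apply: (measurable_iint (F := fun x : measurableTypeR R * 'rV[R]_n =>
  F (vcons x.1 x.2))) => //.
exact: measurable_comp_vcons.
Qed.

Lemma ge0_iintZl n (k : R) (F : 'rV[R]_n -> \bar R) : (0 <= k)%R ->
  measurable_fun setT F -> (forall v, 0 <= F v) ->
  iint (fun v => k%:E * F v) = k%:E * iint F.
Proof.
elim: n F => [//|n IH] F k0 mF F0 /=.
under eq_integral => t _.
  rewrite IH//; first over.
  exact: measurable_comp_vcons.
rewrite ge0_integralZl//.
- exact: measurable_iint_vcons.
- by move=> t _; exact: iint_ge0.
Qed.

Lemma measurable_rVD d (T : measurableType d) n (f g : T -> 'rV[R]_n) :
  measurable_fun setT f -> measurable_fun setT g ->
  measurable_fun setT (fun t => f t + g t)%R.
Proof.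
move=> /measurable_fun_rVP mf /measurable_fun_rVP mg.
apply/measurable_fun_rVP => i; under eq_fun do rewrite mxE.
exact: measurable_funD.
Qed.

Lemma measurable_mulmx d (T : measurableType d) m n (A : 'M[R]_(m, n))
    (f : T -> 'rV[R]_m) :
  measurable_fun setT f -> measurable_fun setT (fun t => f t *m A).
Proof.
move=> /measurable_fun_rVP mf; apply/measurable_fun_rVP => i.
under eq_fun do rewrite mxE.
by apply: measurable_sum => j; apply: measurable_funM => //; exact: mf.
Qed.

Lemma measurable_rVZ d (T : measurableType d) n (f : T -> R) (g : T -> 'rV[R]_n) :
  measurable_fun setT f -> measurable_fun setT g ->
  measurable_fun setT (fun t => f t *: g t)%R.
Proof.
move=> mf /measurable_fun_rVP mg.
apply/measurable_fun_rVP => i; under eq_fun do rewrite mxE.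
exact: measurable_funM.
Qed.

Lemma iint_translate n (w : 'rV[R]_n) (F : 'rV[R]_n -> \bar R) :
  measurable_fun setT F -> (forall v, 0 <= F v) ->
  iint (fun v => F (v + w)%R) = iint F.
Proof.
elim: n w F => [|n IH] w F mF F0 /=; first by congr F; apply/rowP => -[].
pose w' : 'rV[R]_n := \row_i w ord0 (lift ord0 i).
have vE t v : (vcons t v + w = vcons (t + w ord0 ord0) (v + w'))%R.
  apply/rowP => j; rewrite !mxE; case: unliftP => [k ->|->]; last by [].
  by rewrite !mxE.
rewrite (@ge0_integral_affine _ 1%R (w ord0 ord0) (fun t =>
   iint (fun v => F (vcons t v))))//; last 2 first.
- exact: measurable_iint_vcons.
- by move=> t; exact: iint_ge0.
rewrite normr1 mul1e; apply: eq_integral => t _; rewrite mul1r.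
rewrite -[RHS](IH w')//; first by apply: eq_iint => v; rewrite vE.
exact: measurable_comp_vcons.
Qed.

Lemma vins_vcons n (i : 'I_n.+1) (s t : R) (v : 'rV[R]_n) :
  vins (lift ord0 i) s (vcons t v) = vcons t (vins i s v).
Proof.
apply/rowP => j; rewrite !mxE.
case: (unliftP ord0 j) => [k ->|->].
  rewrite !mxE; case: (unliftP i k) => [l ->|->].
    rewrite [X in unlift _ X](_ : _ = lift (lift ord0 i) (lift ord0 l)); last first.
      by apply/val_inj; rewrite /= /bump /= !add1n ltnS addnS.
    by rewrite liftK !mxE liftK.
  by rewrite unlift_none.
rewrite [X in unlift _ X](_ : _ = lift (lift ord0 i) ord0); last exact/val_inj.
by rewrite liftK mxE unlift_none.
Qed.

(** Any coordinate may be integrated outermost: induction brings it to second place, and Tonelli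
    exchanges the first two. *)
Lemma iint_vins n (i : 'I_n.+1) (F : 'rV[R]_n.+1 -> \bar R) :
  measurable_fun setT F -> (forall v, 0 <= F v) ->
  iint F = \int[mu]_t iint (fun v => F (vins i t v)).
Proof.
elim: n i F => [|n IH] i F mF F0; first by rewrite [i]ord1.
case: (unliftP ord0 i) => [k ->|-> //].
transitivity (\int[mu]_t \int[mu]_s iint (fun v => F (vcons t (vins k s v)))).
  apply: eq_integral => t _; rewrite -(IH k (fun v => F (vcons t v)))//.
  exact: measurable_comp_vcons.
rewrite (fubini_tonelli (fun x : measurableTypeR R * measurableTypeR R =>
   iint (fun v => F (vcons x.1 (vins k x.2 v))))); last 2 first.
- apply: (measurable_iint (F := fun x : (measurableTypeR R * measurableTypeR R) * 'rV[R]_n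
    => F (vcons x.1.1 (vins k x.1.2 x.2)))) => //.
  apply: measurable_comp_vcons => //.
    exact: (measurableT_comp measurable_fst measurable_fst).
  apply: measurable_vins => //.
  exact: (measurableT_comp measurable_snd measurable_fst).
- by move=> x; exact: iint_ge0.
apply: eq_integral => t _ /=; apply: eq_integral => s _.
by apply: eq_iint => v; rewrite vins_vcons.
Qed.

End iint_change_of_variables.

(** * Linear changes of variables by Gaussian elimination *)

Section iint_linear.
Variable R : realType.
Local Notation mu := (@lebesgue_measure R).

Lemma vins_eq0 n (i : 'I_n.+1) (t : R) (v : 'rV[R]_n) : vins i t v = 0 -> v = 0.
Proof.
by move=> /rowP tv0; apply/rowP => j; have := tv0 (lift i j); rewrite !mxE liftK.
Qed.

(** Provides the pivot: a zero column [j] would make the diagonal entry [(j, j)] of [invmx A *m A]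
    vanish. *)
Lemma unitmx_col_neq0 n (A : 'M[R]_n) (j : 'I_n) : A \in unitmx ->
  exists i, A i j != 0.
Proof.
move=> Au; apply/existsP; apply: contraT => /existsPn A0.
have /matrixP/(_ j j) := mulVmx Au; rewrite !mxE eqxx big1 => [/eqP|k _].
  by rewrite eq_sym oner_eq0.
by have := A0 k; rewrite negbK => /eqP ->; rewrite mulr0.
Qed.

Section pivot.
Variables (n : nat) (A : 'M[R]_n.+1) (i : 'I_n.+1).

Definition pivot_col : 'cV[R]_n := \col_k A (lift i k) ord0.
Definition pivot_row : 'rV[R]_n := \row_j A i (lift ord0 j).
Definition pivot_schur : 'M[R]_n :=
  (\matrix_(k, j) A (lift i k) (lift ord0 j))
  - (A i ord0)^-1 *: (pivot_col *m pivot_row).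

Hypothesis Ai0 : A i ord0 != 0.

(* Gaussian elimination of the coordinate [i]: the first entry [s] of the
   product replaces the inserted entry [t] as a parameter. *)
Lemma vins_mulmx (t : R) (v : 'rV[R]_n) :
  let s := A i ord0 * t + (v *m pivot_col) ord0 ord0 in
  vins i t v *m A =
  vcons s (v *m pivot_schur + (s / A i ord0) *: pivot_row).
Proof.
move=> s; apply/rowP => j; rewrite mxE (bigD1_ord i)//= mxE unlift_none.
under eq_bigr do rewrite mxE liftK.
rewrite mxE; case: (unliftP ord0 j) => [k ->|->].
  rewrite /pivot_schur mulmxBr -scalemxAr mulmxA !mxE.
  under [in RHS]eq_bigr do rewrite mxE.
  rewrite big_ord_recl big_ord0 addr0 /s !mxE.
  move: (\sum_(_ < n) _ * A _ _) => X; move: (\sum_(_ < n) _) => Y.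
  by field.
by rewrite /s mulrC; congr (_ + _); rewrite mxE; apply: eq_bigr => k _; rewrite mxE.
Qed.

(** A vector in the kernel of the Schur complement extends to one in the kernel of [A], by inserting
    the entry that makes the first coordinate of the product zero. *)
Lemma pivot_schur_unit : A \in unitmx -> pivot_schur \in unitmx.
Proof.
move=> Au; rewrite -row_free_unit; apply: inj_row_free => v vB0.
set q := (v *m pivot_col) ord0 ord0.
apply: (@vins_eq0 _ i (- q / A i ord0)).
have s0 : A i ord0 * (- q / A i ord0) + q = 0 by field.
rewrite -[LHS](mulmxK Au) vins_mulmx vB0 -/q s0 mul0r scale0r addr0.
rewrite (_ : vcons 0 0 = 0) ?mul0mx//.
by apply/rowP => j; rewrite !mxE; case: unlift => // k; rewrite mxE.
Qed.

End pivot.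

Local Open Scope ereal_scope.

(** Induction on the dimension. A pivot [a] in the first column splits the map into a substitution
    of slope [a] in one coordinate, a translation, and the Schur complement on the other
    coordinates. *)
Lemma iint_mulmx n (A : 'M[R]_n) : A \in unitmx ->
  exists2 K : R, (0 < K)%R & forall F : 'rV[R]_n -> \bar R,
    measurable_fun setT F -> (forall v, 0 <= F v) ->
    iint F = K%:E * iint (fun v => F (v *m A)).
Proof.
elim: n A => [|n IH] A Au.
  by exists 1%R => // F mF F0; rewrite mul1e /= mul0mx.
have [i Ai0] := unitmx_col_neq0 ord0 Au.
have [K K0 IHK] := IH _ (pivot_schur_unit Ai0 Au).
set a := A i ord0 in Ai0; set r := pivot_row A i.
set B := pivot_schur A i in IHK.
exists (K * `|a|)%R => [|F mF F0]; first by rewrite mulr_gt0 ?normr_gt0.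
pose q (v : 'rV[R]_n) := (v *m pivot_col A i) ord0 ord0.
have mq : measurable_fun setT q.
  suff /measurable_fun_rVP : measurable_fun setT
    (fun v : 'rV[R]_n => v *m pivot_col A i) by exact.
  exact: measurable_mulmx.
pose G (x : measurableTypeR R * 'rV[R]_n) :=
  F (vcons x.1 (x.2 *m B + (x.1 / a) *: r)).
have mG : measurable_fun setT G.
  apply: measurable_comp_vcons => //; apply: measurable_rVD.
    exact: measurable_mulmx.
  by apply: measurable_rVZ => //; exact: measurable_funM.
have G0 x : 0 <= G x by exact: F0.
(* The intermediate integral has as variables the new first coordinate [s] and the old coordinates
   other than [i]. *)
rewrite EFinM -muleA [X in K%:E * X](_ : _ = iint (fun v => \int[mu]_s G (s, v))).
  rewrite -(integral_iint mu mG G0) -ge0_integralZl//; last 3 first.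
  - exact: (measurable_iint mG G0).
  - by move=> x _; exact: iint_ge0.
  - by rewrite lee_fin ltW.
  apply: eq_integral => s _; rewrite /G.
  (* For fixed [s], the induction hypothesis removes [B], and the remaining shift by [(s / a) *: r]
     is a translation. *)
  rewrite -(IHK (fun w => F (vcons s (w + (s / a) *: r))))//=.
    rewrite (iint_translate _ (F := fun w => F (vcons s w)))//.
    exact: measurable_comp_vcons.
  apply: measurable_comp_vcons => //; exact: measurable_rVD.
rewrite (iint_vins i); last 2 first.
- apply: (measurableT_comp mF); exact: measurable_mulmx.
- by move=> v; exact: F0.
under eq_integral => t _.
  under eq_iint => v do rewrite vins_mulmx//.
  over.
pose H (x : measurableTypeR R * 'rV[R]_n) := G ((a * x.1 + q x.2)%R, x.2).
have mH : measurable_fun setT H.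
  apply: (measurableT_comp mG); apply: measurable_fun_pair => //.
  apply: measurable_funD; first exact: measurable_funM.
  exact: (measurableT_comp mq measurable_snd).
rewrite -[\int[mu]_t _]/(\int[mu]_t iint (fun v => H (t, v))).
rewrite (integral_iint mu mH (fun x => G0 _)) -ge0_iintZl//; last 2 first.
- exact: (measurable_fun_fubini_tonelli_G (m1 := mu) _ mH (fun x => G0 _)).
- by move=> v; apply: integral_ge0 => s _; exact: G0.
apply: eq_iint => v.
(* The substitution [s = a * t + q v], at fixed [v], produces the factor [|a|]. *)
rewrite [RHS](@ge0_integral_affine _ a (q v))//.
by apply: (measurableT_comp mG); exact: measurable_pair2.
Qed.

End iint_linear.

(** * Integration over the orthant *)

Section ftc.
Variable R : realType.
Local Notation mu := (@lebesgue_measure R).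

Lemma derivable_continuous (f : R -> R) :
  (forall x, derivable f x 1) -> continuous f.
Proof.
by move=> df x; apply: differentiable_continuous; exact/derivable1_diffP.
Qed.

Lemma integral_primitive (f F : R -> R) (a b : R) : a <= b ->
  continuous f -> (forall x : R, is_derive x 1 F (f x)) ->
  (\int[mu]_(x in `[a, b]) (f x)%:E = (F b - F a)%:E)%E.
Proof.
rewrite le_eqVlt => /predU1P[->|ab] cf dF.
  by rewrite set_itv1 integral_set1 subrr.
have cF : continuous F by apply: derivable_continuous => x; exact: ex_derive.
rewrite (@continuous_FTC2 _ f F)//.
- exact: continuous_subspaceT.
- split=> [x _||]; first exact: ex_derive.
  + exact/cvg_at_right_filter/cF.
  + exact/cvg_at_left_filter/cF.
- by move=> x _; rewrite derive1E; exact: derive_val.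
Qed.

(** Divided powers: each one is the derivative of the next, which keeps factorials out of the
    integrations. *)
Definition pexp (n : nat) (s : R) : R := s ^+ n / n`!%:R.

Lemma pexp_ge0 n s : 0 <= s -> 0 <= pexp n s.
Proof. by move=> s0; rewrite divr_ge0// ?exprn_ge0// ler0n. Qed.

Lemma fact_neq0 n : n`!%:R != 0 :> R.
Proof. by rewrite pnatr_eq0 -lt0n fact_gt0. Qed.

Lemma pexpS0 n : pexp n.+1 0 = 0.
Proof. by rewrite /pexp expr0n mul0r. Qed.

Lemma pexp0s s : pexp 0 s = 1.
Proof. by rewrite /pexp expr0 fact0 divr1. Qed.

Lemma pexp_mull n k s : pexp n (k * s) = k ^+ n * pexp n s.
Proof. by rewrite /pexp exprMn mulrA. Qed.

Lemma mulr_pexp n s : s * pexp n s = n.+1%:R * pexp n.+1 s.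
Proof.
rewrite /pexp factS natrM exprS; have := fact_neq0 n => n0.
have : n.+1%:R != 0 :> R by rewrite pnatr_eq0.
by move: (n.+1%:R : R) => k k0; field; rewrite n0.
Qed.

Lemma is_derive_pexp n (s : R) : is_derive s 1 (pexp n.+1) (pexp n s).
Proof.
rewrite (_ : pexp n.+1 = ((n.+1)`!%:R)^-1 \*: (@id R ^+ n.+1)); last first.
  by apply/funext => t; rewrite /pexp mulrC /= exprfctE.
apply: is_derive_eq; rewrite /pexp factS natrM; have := fact_neq0 n => n0.
rewrite /GRing.scale/= mulr1 -mulr_natl -mulrA.
have : n.+1%:R != 0 :> R by rewrite pnatr_eq0.
by move: (n.+1%:R : R) => k k0; field; rewrite n0.
Qed.

Lemma continuous_pexp n : continuous (pexp n).
Proof.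
case: n => [|n]; last first.
  by apply: derivable_continuous => s; exact: (ex_derive (is_derive := is_derive_pexp n s)).
by rewrite (_ : pexp 0 = cst 1) => [s|]; [exact: cvg_cst|apply/funext => s; rewrite pexp0s].
Qed.

Lemma measurable_pexp n : measurable_fun setT (pexp n).
Proof. by apply: continuous_measurable_fun; exact: continuous_pexp. Qed.

End ftc.

Section orthant.
Variable R : realType.
Local Notation mu := (@lebesgue_measure R).

Definition orthant n (v : 'rV[R]_n) : bool := [forall i, 0 <= v ord0 i].
Definition vsum n (v : 'rV[R]_n) : R := \sum_i v ord0 i.

Lemma orthant_vcons n t (v : 'rV[R]_n) :
  orthant (vcons t v) = (0 <= t) && orthant v.
Proof.
apply/forallP/andP => [H|[t0 /forallP v0] i].
  split; first by have := H ord0; rewrite mxE unlift_none.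
  by apply/forallP => i; have := H (lift ord0 i); rewrite mxE liftK.
by rewrite mxE; case: unlift.
Qed.

Lemma vsum_vcons n t (v : 'rV[R]_n) : vsum (vcons t v) = t + vsum v.
Proof.
rewrite /vsum big_ord_recl mxE unlift_none; congr (_ + _).
by apply: eq_bigr => i _; rewrite mxE liftK.
Qed.

Lemma orthant_vsum_ge0 n (v : 'rV[R]_n) : orthant v -> 0 <= vsum v.
Proof. by move=> /forallP v0; apply: sumr_ge0 => i _; exact: v0. Qed.

Lemma measurable_fun_all d (T : measurableType d) (I : Type) (r : seq I)
    (f : I -> T -> bool) : (forall i, measurable_fun setT (f i)) ->
  measurable_fun setT (fun t => all (f^~ t) r).
Proof.
move=> mf; elim: r => [|i r IH] /=; first exact: measurable_cst.
exact: measurable_and.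
Qed.

Lemma measurable_orthant n : measurable_fun setT (@orthant n).
Proof.
rewrite (_ : @orthant n = fun v => all (fun i => 0 <= v ord0 i) (enum 'I_n)).
  apply: measurable_fun_all => i; apply: measurable_fun_ler => //.
  exact: measurable_coord.
apply/funext => v; apply/forallP/allP => [H i _|H i]; first exact: H.
by apply: H; rewrite mem_enum.
Qed.

Lemma measurable_vsum n : measurable_fun setT (@vsum n).
Proof. by apply: measurable_sum => i; exact: measurable_coord. Qed.

Local Open Scope ereal_scope.

Lemma integral_if_itv (f : R -> \bar R) (a b : R) :
  \int[mu]_(s in `[a, b]) f s = \int[mu]_s (if (a <= s <= b)%R then f s else 0).
Proof.
rewrite integral_mkcond; apply: eq_integral => s _.
by rewrite patchE mem_setE in_itv.
Qed.

Lemma iint0 n : iint (fun _ : 'rV[R]_n => 0) = 0.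
Proof. by elim: n => //= n ->; rewrite integral0. Qed.

(** On the orthant of dimension [n.+1], the coordinate sum has density [pexp n]. One more coordinate
    convolves this density with the constant 1, and [pexp n (r - t)] integrated over [t] from 0 to
    [r] is [pexp n.+1 r]. *)
Lemma iint_orthant n (g : R -> \bar R) :
  measurable_fun setT g -> (forall s, 0 <= g s) ->
  iint (fun v : 'rV[R]_n.+1 => if orthant v then g (vsum v) else 0) =
  \int[mu]_s (if (0 <= s)%R then (pexp n s)%:E * g s else 0).
Proof.
elim: n g => [|n IH] g mg g0.
  rewrite [LHS]/=; apply: eq_integral => t _.
  rewrite orthant_vcons vsum_vcons pexp0s mul1e (_ : orthant 0 = true).
    by rewrite andbT (_ : vsum 0 = 0%R) ?addr0// /vsum big_ord0.
  by apply/forallP => -[].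
have mgt (t : R) : measurable_fun setT (fun s : R => g (t + s)%R).
  by apply: (measurableT_comp mg); exact: measurable_funD.
(* Here [t] is the first coordinate and [r] the total, so that [r - t] is the sum of the remaining
   coordinates. *)
transitivity (\int[mu]_t \int[mu]_r
    (if (0 <= t <= r)%R then (pexp n (r - t))%:E * g r else 0)).
  apply: eq_integral => t _.
  transitivity (if (0 <= t)%R then
      iint (fun v : 'rV[R]_n.+1 => if orthant v then g (t + vsum v)%R else 0)
    else iint (fun v : 'rV[R]_n.+1 => 0)).
    rewrite -[LHS]/(iint (fun v : 'rV[R]_n.+1 =>
      if orthant (vcons t v) then g (vsum (vcons t v)) else 0)).
    case: ifPn => t0; apply: eq_iint => v.
      by rewrite orthant_vcons vsum_vcons t0.
    by rewrite orthant_vcons (negbTE t0).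
  case: ifPn => t0; last first.
    by rewrite iint0 /= integral0.
  rewrite (IH (fun s => g (t + s)%R))//.
  rewrite [RHS](@ge0_integral_affine _ 1%R t)//.
  - rewrite normr1 mul1e; apply: eq_integral => s _.
    by rewrite mul1r addrK lerDr [in RHS]addrC.
  - apply: measurable_fun_ifT => //.
      by apply: measurable_and => //; exact: measurable_fun_ler.
    apply: emeasurable_funM => //; apply/measurable_EFinP.
    apply: (measurableT_comp (@measurable_pexp _ n)).
    exact: measurable_funB.
  - move=> r; case: ifPn => // tr; rewrite mule_ge0// lee_fin pexp_ge0//.
    by rewrite subr_ge0.
rewrite (fubini_tonelli (fun x : measurableTypeR R * measurableTypeR R =>
  if (0 <= x.1 <= x.2)%R then (pexp n (x.2 - x.1))%:E * g x.2 else 0)); last 2 first.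
- apply: measurable_fun_ifT => //.
    by apply: measurable_and => //; exact: measurable_fun_ler.
  apply: emeasurable_funM => //.
    apply/measurable_EFinP; apply: (measurableT_comp (@measurable_pexp _ n)).
    exact: measurable_funB.
  exact: (measurableT_comp mg).
- move=> [t r]/=; case: ifPn => // /andP[t0 tr].
  by rewrite mule_ge0// lee_fin pexp_ge0// subr_ge0.
apply: eq_integral => r _ /=.
have [r0|r0] := leP 0%R r; last first.
  under eq_integral => t _.
    rewrite ifF; first over.
    by apply/negbTE; apply/negP => /andP[t0 /(le_trans t0)]; rewrite leNgt r0.
  by rewrite integral0.
rewrite -integral_if_itv ge0_integralZr//; last 2 first.
- apply/measurable_EFinP/measurable_funTS.
  by apply: (measurableT_comp (@measurable_pexp _ n)); exact: measurable_funB.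
- by move=> t /=; rewrite in_itv/= => /andP[t0 tr]; rewrite lee_fin pexp_ge0// subr_ge0.
congr (_ * _).
have cf : continuous (fun t : R => pexp n (r - t)).
  move=> t; apply: (@continuous_comp R R R (fun t => r - t)%R (pexp n));
    last exact: continuous_pexp.
  by apply: continuousB => //; exact: cst_continuous.
have dF (t : R) : is_derive t 1%R (fun t => - pexp n.+1 (r - t))%R (pexp n (r - t)).
  rewrite (_ : (fun t => _) = (- (pexp n.+1 \o (cst (r : R) - id)))%R)//.
  have dp := is_derive_pexp n ((cst (r : R) - id)%R t).
  by apply: is_derive_eq; rewrite /GRing.scale/=; ring.
rewrite (integral_primitive r0 cf dF).
by rewrite subrr pexpS0 oppr0 addr0 sub0r opprK.
Qed.

End orthant.

(** * Simplices *)

Section dotr_theory.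
Variables (R : realType) (d : nat).
Implicit Types c x y : 'rV[R]_d.

Lemma dotrD c x y : dotr c (x + y) = dotr c x + dotr c y.
Proof.
by rewrite /dotr -big_split; apply: eq_bigr => i _; rewrite mxE mulrDr.
Qed.

Lemma dotrZ c k x : dotr c (k *: x) = k * dotr c x.
Proof.
by rewrite /dotr big_distrr; apply: eq_bigr => i _; rewrite mxE/= mulrCA.
Qed.

Lemma dotrB c x y : dotr c (x - y) = dotr c x - dotr c y.
Proof. by rewrite dotrD -scaleN1r dotrZ mulN1r. Qed.

Lemma dotr_sum c (I : finType) (F : I -> 'rV[R]_d) :
  dotr c (\sum_i F i) = \sum_i dotr c (F i).
Proof.
apply: (big_morph _ (dotrD c)).
by rewrite /dotr big1// => i _; rewrite mxE mulr0.
Qed.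

Lemma measurable_dotr c : measurable_fun setT (dotr c).
Proof.
by apply: measurable_sum => i; apply: measurable_funM => //; exact: measurable_coord.
Qed.

End dotr_theory.

Section simplex.
Variables (R : realType) (n : nat) (v : 'I_n.+2 -> 'rV[R]_n.+1).

Definition edge_mx : 'M[R]_n.+1 := \matrix_(i < n.+1) (v (lift ord0 i) - v ord0).

Lemma mulmx_edge (lam : 'rV[R]_n.+1) :
  lam *m edge_mx = \sum_i lam ord0 i *: (v (lift ord0 i) - v ord0).
Proof. by rewrite mulmx_sum_row; apply: eq_bigr => i _; rewrite rowK. Qed.

Lemma sum_vertices (l : 'I_n.+2 -> R) :
  \sum_i l i *: v i =
  (\row_i l (lift ord0 i)) *m edge_mx + (\sum_i l i) *: v ord0.
Proof.
rewrite mulmx_edge [\sum_i l i]big_ord_recl [LHS]big_ord_recl scalerDl addrCA.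
congr (_ + _); rewrite scaler_suml -big_split; apply: eq_bigr => i _ /=.
by rewrite mxE scalerBr subrK.
Qed.

(** A linear form with the same drop [u] along all edges from [v ord0] sees [lam] only through its
    sum. This serves both for the exponent and for the slope of [mu]. *)
Lemma dotr_edge (c lam : 'rV[R]_n.+1) (u z : R) :
  (forall j, j != ord0 -> dotr c (v ord0) - dotr c (v j) = u) ->
  dotr c (lam *m edge_mx + z *: v ord0) = z * dotr c (v ord0) - u * vsum lam.
Proof.
move=> cu; rewrite dotrD dotrZ addrC mulmx_edge dotr_sum; congr (_ + _).
rewrite /vsum big_distrr -sumrN; apply: eq_bigr => i _ /=.
by rewrite dotrZ dotrB -(cu (lift ord0 i))// -mulNr opprB mulrC.
Qed.

Hypothesis vindep : aff_indep v.

(** A linear relation between the edges becomes an affine relation between the vertices once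
    [v ord0] receives minus the sum of the coefficients. *)
Lemma edge_mx_unit : edge_mx \in unitmx.
Proof.
rewrite -row_free_unit; apply: inj_row_free => lam lam0.
pose l i := if unlift ord0 i is Some j then lam ord0 j else - vsum lam.
have lE : \row_i l (lift ord0 i) = lam.
  by apply/rowP => i; rewrite mxE /l liftK.
have suml : \sum_i l i = 0.
  rewrite big_ord_recl {1}/l unlift_none; apply/eqP; rewrite addrC subr_eq0.
  by apply/eqP/eq_bigr => i _; rewrite /l liftK.
have l0 : \sum_i l i *: v i = 0 by rewrite sum_vertices suml lE lam0 scale0r addr0.
by apply/rowP => i; have := vindep suml l0 (lift ord0 i); rewrite /l liftK mxE.
Qed.

(** The entries of [lam] are [z] times the barycentric weights; [v ord0] takes up the slack
    [z - vsum lam]. *)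
Lemma scale_conv_hullP (z : R) (lam : 'rV[R]_n.+1) : 0 < z ->
  scale_set z (conv_hull v) (lam *m edge_mx + z *: v ord0) <->
  orthant lam && (vsum lam <= z).
Proof.
move=> z0; split=> [[w [l [l0 [suml ->]]]]|/andP[/forallP lam0 lamz]].
  rewrite sum_vertices suml scalerDr scale1r => /addIr.
  rewrite scalemxAl => /(can_inj (mulmxK edge_mx_unit)) <-.
  apply/andP; split.
    by apply/forallP => i; rewrite !mxE mulr_ge0// ltW.
  have -> : vsum (z *: \row_i l (lift ord0 i)) = z * (\sum_i l (lift ord0 i)).
    by rewrite /vsum big_distrr; apply: eq_bigr => i _; rewrite !mxE.
  rewrite -[leRHS]mulr1 ler_pM2l// -suml [leRHS]big_ord_recl.
  by rewrite lerDr.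
pose l i := if unlift ord0 i is Some j then z^-1 * lam ord0 j
            else 1 - z^-1 * vsum lam.
have lE : \row_i l (lift ord0 i) = z^-1 *: lam.
  by apply/rowP => i; rewrite !mxE /l liftK.
have suml : \sum_i l i = 1.
  rewrite big_ord_recl {1}/l unlift_none.
  rewrite (eq_bigr (fun i => z^-1 * lam ord0 i)).
    by rewrite -big_distrr/= subrK.
  by move=> i _; rewrite /l liftK.
exists (\sum_i l i *: v i).
  exists l; split=> // i; rewrite /l; case: unlift => [j|].
    by rewrite mulr_ge0// invr_ge0 ltW.
  by rewrite subr_ge0 mulrC ler_pdivrMr// mul1r.
by rewrite sum_vertices suml lE scale1r scalerDr -scalemxAl scalerA divff ?gt_eqF// scale1r.
Qed.

(** Linear in [(x, z)], with no division by [z], hence measurable and continuous up to [z = 0]. *)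
Definition bary (x : 'rV[R]_n.+1) (z : R) : 'rV[R]_n.+1 :=
  (x - z *: v ord0) *m invmx edge_mx.

Lemma baryK x z : bary x z *m edge_mx + z *: v ord0 = x.
Proof. by rewrite mulmxKV ?edge_mx_unit// subrK. Qed.

Lemma mulmx_edgeK lam z : bary (lam *m edge_mx + z *: v ord0) z = lam.
Proof. by rewrite /bary addrK mulmxK ?edge_mx_unit. Qed.

Lemma scale_conv_hull_bary (z : R) (x : 'rV[R]_n.+1) : 0 < z ->
  scale_set z (conv_hull v) x <-> orthant (bary x z) && (vsum (bary x z) <= z).
Proof. by move=> z0; rewrite -{1}(baryK x z); exact: scale_conv_hullP. Qed.

Lemma measurable_bary d (T : measurableType d) (f : T -> 'rV[R]_n.+1) (g : T -> R) :
  measurable_fun setT f -> measurable_fun setT g ->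
  measurable_fun setT (fun t => bary (f t) (g t)).
Proof.
move=> mf mg; apply: measurable_mulmx; apply: measurable_rVD => //.
under eq_fun do rewrite -scaleNr.
apply: measurable_rVZ => //; exact: (measurableT_comp (@oppr_measurable _ setT)).
Qed.

End simplex.

(** * Volume of the simplex and of regions fibred over its multiples *)

Section simplex_volume.
Variables (R : realType) (n : nat) (v : 'I_n.+2 -> 'rV[R]_n.+1).
Hypothesis vindep : aff_indep v.
Local Notation mu := (@lebesgue_measure R).
Local Notation J := (conv_hull v).

Local Open Scope ereal_scope.

(** [K] stands for the absolute determinant of [edge_mx v] and is specified by the formula it
    satisfies, so that one [K] serves [vol J] and both relaxations. *)
Definition simplex_jacobian (K : R) := forall F : 'rV[R]_n.+1 -> \bar R,
  measurable_fun setT F -> (forall x, 0 <= F x) ->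
  iint F = K%:E * iint (fun lam => F (lam *m edge_mx v)).

Lemma simplex_jacobian_ex : exists2 K : R, (0 < K)%R & simplex_jacobian K.
Proof. exact: iint_mulmx (edge_mx_unit vindep). Qed.

Variable K : R.
Hypothesis HK : simplex_jacobian K.

Lemma iint_simplex (z : R) (F : 'rV[R]_n.+1 -> \bar R) (g : R -> \bar R) :
  measurable_fun setT F -> (forall x, 0 <= F x) ->
  measurable_fun setT g -> (forall s, 0 <= g s) ->
  (forall lam, F (lam *m edge_mx v + z *: v ord0)%R =
     if orthant lam then g (vsum lam) else 0) ->
  iint F = K%:E * \int[mu]_s (if (0 <= s)%R then (pexp n s)%:E * g s else 0).
Proof.
move=> mF F0 mg g0 Fg; rewrite -(iint_translate (z *: v ord0) mF F0).
rewrite HK//; last first.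
  by apply: (measurableT_comp mF); exact: measurable_rVD.
by rewrite -iint_orthant//; congr (_ * _); apply: eq_iint => lam; exact: Fg.
Qed.

(** [J] is its own multiple at [z = 1], and the density [pexp n] has integral [pexp n.+1 1] over
    [[0, 1]]. *)
Lemma vol_simplex : vol J = (K / (n.+1)`!%:R)%:E.
Proof.
have JE x : J x <-> orthant (bary v x 1) && (vsum (bary v x 1) <= 1)%R.
  rewrite -scale_conv_hull_bary//; split=> [Jx|[w Jw <-]]; last by rewrite scale1r.
  by exists x => //; rewrite scale1r.
pose F (x : 'rV[R]_n.+1) : \bar R :=
  if orthant (bary v x 1) && (vsum (bary v x 1) <= 1)%R then 1 else 0.
have mb : measurable_fun setT (fun x : 'rV[R]_n.+1 => bary v x 1).
  by apply: measurable_bary => //; exact: measurable_id.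
have -> : vol J = iint F.
  apply: eq_iint => x; rewrite indicE /F.
  case: ifPn => [/JE Jx|/negP nJx]; first by rewrite mem_set.
  by rewrite memNset// => /JE.
rewrite (@iint_simplex 1 F (fun s => if (s <= 1)%R then 1 else 0)).
- transitivity (K%:E * \int[mu]_(s in `[0%R, 1%R]) (pexp n s)%:E).
    rewrite integral_if_itv; congr (_ * _); apply: eq_integral => s _.
    by case: (0 <= s)%R => //=; case: (s <= 1)%R => //=; rewrite ?mule1 ?mule0.
  rewrite (integral_primitive ler01 (@continuous_pexp _ n) (is_derive_pexp n)).
  by rewrite pexpS0 subr0 -EFinM /pexp expr1n mul1r.
- apply: measurable_fun_ifT => //; apply: measurable_and.
    exact: (measurableT_comp (@measurable_orthant _ _)).
  apply: measurable_fun_ler => //.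
  exact: (measurableT_comp (@measurable_vsum _ _)).
- by move=> x; rewrite /F; case: ifP.
- by apply: measurable_fun_ifT => //; exact: measurable_fun_ler.
- by move=> s; case: ifP.
- by move=> lam; rewrite /F mulmx_edgeK//; case: orthant.
Qed.

Section region.
Variables (S : set ('rV[R]_n.+1 * R * R)) (l m : 'rV[R]_n.+1 -> R -> R) (L M : R -> R -> R).
Hypothesis SE : forall x y z, z != 0%R ->
  S (x, y, z) <-> [/\ (0 < z <= 1)%R, scale_set z J x & (l x z <= y <= m x z)%R].
Hypothesis ml : measurable_fun setT (fun p : 'rV[R]_n.+1 * R => l p.1 p.2).
Hypothesis mm : measurable_fun setT (fun p : 'rV[R]_n.+1 * R => m p.1 p.2).
Hypothesis lL : forall lam z, (0 < z)%R ->
  l (lam *m edge_mx v + z *: v ord0)%R z = L z (vsum lam).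
Hypothesis mM : forall lam z, (0 < z)%R ->
  m (lam *m edge_mx v + z *: v ord0)%R z = M z (vsum lam).
Hypothesis mL : forall z, measurable_fun setT (L z).
Hypothesis mM' : forall z, measurable_fun setT (M z).
Hypothesis LM : forall z s, (0 < z <= 1)%R -> (0 <= s <= z)%R -> (L z s <= M z s)%R.

Let base (x : 'rV[R]_n.+1) (z : R) : bool :=
  [&& (0 < z)%R, (z <= 1)%R, orthant (bary v x z) & (vsum (bary v x z) <= z)%R].
Let ind (x : 'rV[R]_n.+1) (y z : R) : \bar R :=
  if base x z && (l x z <= y <= m x z)%R then 1 else 0.

Let ind_ge0 x y z : 0 <= ind x y z.
Proof. by rewrite /ind; case: ifP. Qed.

Let measurable_ind d (T : measurableType d) (f : T -> 'rV[R]_n.+1) (g h : T -> R) :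
  measurable_fun setT f -> measurable_fun setT g -> measurable_fun setT h ->
  measurable_fun setT (fun t => ind (f t) (g t) (h t)).
Proof.
move=> mf mg mh; apply: measurable_fun_ifT => //.
have mp : measurable_fun setT (fun t => (f t, h t)) by exact: measurable_fun_pair.
have mb : measurable_fun setT (fun t => bary v (f t) (h t)) by exact: measurable_bary.
apply: measurable_and; last first.
  apply: measurable_and; apply: measurable_fun_ler => //.
    exact: (measurableT_comp ml mp).
  exact: (measurableT_comp mm mp).
apply: measurable_and; first exact: measurable_fun_ltr.
apply: measurable_and; first exact: measurable_fun_ler.
apply: measurable_and.
  exact: (measurableT_comp (@measurable_orthant _ _)).
apply: measurable_fun_ler => //.
exact: (measurableT_comp (@measurable_vsum _ _)).
Qed.

Let indE x y z : z != 0%R -> (\1_S (x, y, z))%:E = ind x y z.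
Proof.
move=> z0; rewrite indicE /ind.
case: ifPn => [/andP[/and4P[zgt0 z1 ol sl] lm]|nS].
  rewrite mem_set//; apply/SE => //; split=> //; first exact/andP.
  by apply/scale_conv_hull_bary => //; exact/andP.
rewrite memNset// => /SE -/(_ z0)[/andP[zgt0 z1]].
move=> /scale_conv_hull_bary -/(_ vindep zgt0)/andP[ol sl] lm.
by move/negP : nS; apply; rewrite /base zgt0 z1 ol sl lm.
Qed.

(** [SE] is silent on the slice [z = 0], so this null point is removed from both integrals; away
    from it, the measurability of the indicator of [S] is that of [ind]. *)
Let integral_indic_z x y : \int[mu]_z (\1_S (x, y, z))%:E = \int[mu]_z ind x y z.
Proof.
have mi : measurable_fun setT (ind x y) by exact: measurable_ind.
rewrite -[LHS](@integral_setD1 _ _ 0%R)//; last 2 first.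
- exact: measurableD.
- apply: (eq_measurable_fun (ind x y)).
    by move=> z /[!inE] -[_ /eqP z0]; rewrite indE.
  exact: measurable_funS mi.
rewrite -[RHS](@integral_setD1 _ _ 0%R)//; last 2 first.
- exact: measurableD.
- exact: measurable_funS mi.
by apply: eq_integral => z /[!inE] -[_ /eqP z0]; rewrite indE.
Qed.

(** Tonelli brings [z] outermost. At fixed [z], the fibre in [y] has length [M - L], a function of
    [vsum] alone, and [iint_simplex] leaves one integral over [s]. *)
Lemma vol3_region : vol3 S =
  \int[mu]_(z in `]0%R, 1%R]) (K%:E *
    \int[mu]_(s in `[0%R, z]) (pexp n s * (M z s - L z s))%:E).
Proof.
pose Psi (p : measurableTypeR R * 'rV[R]_n.+1) := \int[mu]_y ind p.2 y p.1.
have mPsi : measurable_fun setT Psi.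
  apply: (measurable_fun_fubini_tonelli_F (m2 := mu)
    (fun p : (measurableTypeR R * 'rV[R]_n.+1) * measurableTypeR R =>
      ind p.1.2 p.2 p.1.1)) => //.
  apply: measurable_ind => //.
    exact: (measurableT_comp measurable_snd measurable_fst).
  exact: (measurableT_comp measurable_fst measurable_fst).
have Psi0 p : 0 <= Psi p by apply: integral_ge0 => y _; exact: ind_ge0.
transitivity (iint (fun x => \int[mu]_z Psi (z, x))).
  apply: eq_iint => x.
  under eq_integral do rewrite integral_indic_z.
  rewrite (fubini_tonelli (fun p : measurableTypeR R * measurableTypeR R =>
    ind x p.1 p.2))//.
  by apply: measurable_ind => //; exact: measurable_cst.
rewrite -(integral_iint mu mPsi Psi0) [RHS]integral_mkcond.
apply: eq_integral => z _; rewrite patchE.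
have -> : (z \in `]0%R, 1%R]%classic) = (0 < z <= 1)%R by rewrite mem_setE in_itv.
(* The guards make [g] nonnegative for every [s], as [LM] compares [L] with [M] only under them. *)
pose g (s : R) : \bar R :=
  if [&& 0 <= s, 0 < z, z <= 1 & s <= z]%R then (M z s - L z s)%:E else 0.
rewrite (@iint_simplex z _ g).
- case: ifPn => z01.
    rewrite integral_if_itv; congr (_ * _); apply: eq_integral => s _.
    rewrite /g; move/andP: z01 => [-> ->].
    case: (0 <= s)%R => //=; case: (s <= z)%R; last by rewrite mule0.
    by rewrite EFinM.
  rewrite integral0_eq ?mule0// => s _; rewrite /g.
  by case: (0 <= s)%R => //=; rewrite andbA (negbTE z01) mule0.
- apply: (measurableT_comp mPsi); exact: measurable_pair1.
- by move=> x; exact: Psi0.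
- apply: measurable_fun_ifT => //; last first.
    by apply/measurable_EFinP; exact: measurable_funB.
  apply: measurable_and; first exact: measurable_fun_ler.
  apply: measurable_and; first exact: measurable_cst.
  by apply: measurable_and; [exact: measurable_cst|exact: measurable_fun_ler].
- move=> s; rewrite /g; case: ifPn => // /and4P[s0 z0 z1 sz].
  by rewrite lee_fin subr_ge0 LM// ?s0 ?sz ?z0 ?z1.
move=> lam; rewrite /Psi/= /ind /base mulmx_edgeK//.
have [z0|z0] := ltP 0%R z; last first.
  under eq_integral do rewrite /=.
  by rewrite integral0 /g ltNge z0 /= andbF; case: ifP.
have [ol|ol] := boolP (orthant lam); last first.
  under eq_integral do rewrite andbF/=.
  by rewrite integral0.
under eq_integral do rewrite lL// mM//.
rewrite /g (orthant_vsum_ge0 ol) z0 /=.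
have [zs|] := boolP ((z <= 1)%R && (vsum lam <= z)%R); last first.
  by move=> H; rewrite integral0.
under eq_integral do rewrite /=.
rewrite -(integral_if_itv (fun=> 1)) integral_cst//= mul1e lebesgue_measure_itv/=.
(* The length formula distinguishes whether [L < M]; otherwise [LM] forces equality and both sides
   are 0. *)
rewrite lte_fin; case: ifPn => [//|]; rewrite -leNgt => ML.
have : (L z (vsum lam) <= M z (vsum lam))%R.
  by move/andP: zs => [z1 sz]; apply: LM; rewrite ?z0 ?z1 ?sz ?orthant_vsum_ge0.
by move=> LM'; have /eqP -> : L z (vsum lam) == M z (vsum lam);
  [rewrite eq_le LM' ML|rewrite subrr].
Qed.

End region.
End simplex_volume.

(** * Primitives of the exponential integrands *)

Section exp_primitives.
Variable R : realType.
Local Notation mu := (@lebesgue_measure R).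
Implicit Types (k s z : R) (n : nat).

(** The tangent at the mean [m] lies below the exponential at [a] and at [b]; averaging the two
    inequalities cancels the linear terms. *)
Lemma expR_convex (t a b : R) : 0 <= t <= 1 ->
  expR ((1 - t) * a + t * b) <= (1 - t) * expR a + t * expR b.
Proof.
move=> /andP[t0 t1].
have tangent (m y : R) : expR m * (1 + (y - m)) <= expR y.
  rewrite -[in leRHS](subrK m y) expRD mulrC.
  by rewrite ler_pM2r ?expR_gt0// expR_ge1Dx.
set m := (1 - t) * a + t * b.
have ta := ler_wpM2l (_ : 0 <= 1 - t) (tangent m a).
have tb := ler_wpM2l t0 (tangent m b).
apply: le_trans (lerD (ta _) tb); last by rewrite subr_ge0.
by rewrite le_eqVlt; apply/orP; left; apply/eqP; rewrite /m; ring.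
Qed.

Lemma is_derive_expRM k s : is_derive s 1 (fun s => expR (k * s)) (k * expR (k * s)).
Proof.
rewrite (_ : (fun s => _) = expR \o (k \*: @id R))//.
by apply: is_derive_eq; rewrite /GRing.scale/=; ring.
Qed.

Definition exp_partial n k : R := \sum_(j < n) k ^+ j / j`!%:R.

(** The regularised upper incomplete gamma function of order [n] at [k * s]. *)
Definition texp n k s : R := expR (- k * s) * exp_partial n (k * s).

Lemma texp0 n k : texp n.+1 k 0 = 1.
Proof.
rewrite /texp /exp_partial !mulr0 expR0 mul1r big_ord_recl expr0 fact0 divr1.
by rewrite big1 ?addr0// => j _; rewrite expr0n mul0r.
Qed.

Lemma texpS n k s : texp n.+1 k s = texp n k s + k ^+ n * (expR (- k * s) * pexp n s).
Proof.
rewrite /texp /exp_partial big_ord_recr mulrDr; congr (_ + _).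
by rewrite -/(pexp n (k * s)) pexp_mull mulrCA.
Qed.

(** The derivative telescopes: each further Taylor term cancels what the previous ones left, and
    only the last survives. *)
Lemma is_derive_texp n k s :
  is_derive s 1 (texp n.+1 k) (- (k ^+ n.+1 * (expR (- k * s) * pexp n s))).
Proof.
elim: n => [|n IH].
  rewrite (_ : texp 1 k = fun s => expR (- k * s)); last first.
    by apply/funext => t; rewrite /texp /exp_partial big_ord1 expr0 fact0 divr1 mulr1.
  have de := is_derive_expRM (- k) s.
  by apply: is_derive_eq; rewrite pexp0s; ring.
rewrite (_ : texp n.+2 k = texp n.+1 k + k ^+ n.+1 \*:
  ((fun s => expR (- k * s)) * pexp n.+1)); last first.
  by apply/funext => t; rewrite texpS.
have de := is_derive_expRM (- k) s; have dp := is_derive_pexp n s.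
by apply: is_derive_eq; rewrite /GRing.scale/= !exprS; ring.
Qed.

Lemma continuous_texp n k : continuous (texp n.+1 k).
Proof.
by apply: derivable_continuous => s; have := is_derive_texp n k s => -[].
Qed.

Lemma continuous_expRM k : continuous (fun s => expR (k * s)).
Proof.
by apply: derivable_continuous => s; have := is_derive_expRM k s => -[].
Qed.

(** Term by term: [s * pexp n s] is a multiple of [pexp n.+1 s], and the exponential term has a
    multiple of [texp n.+1 k] as primitive. The [- 1] is the value of [texp] at 0. *)
Lemma integral_pexp_expR n (A B C k z : R) : k != 0 -> 0 <= z ->
  (\int[mu]_(s in `[0%R, z]) (pexp n s * (A + B * s - C * expR (- k * s)))%:E =
   (A * pexp n.+1 z + B * n.+1%:R * pexp n.+2 z
    + C / k ^+ n.+1 * (texp n.+1 k z - 1))%:E)%E.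
Proof.
move=> k0 z0.
pose F := A \*: @pexp R n.+1 + (B * n.+1%:R) \*: @pexp R n.+2
  + (C / k ^+ n.+1) \*: texp n.+1 k.
have cf : continuous (fun s => pexp n s * (A + B * s - C * expR (- k * s))).
  move=> s; apply: continuousM; first exact: continuous_pexp.
  apply: continuousB; last first.
    by apply: continuousM; [exact: cst_continuous|exact: continuous_expRM].
  apply: continuousD; first exact: cst_continuous.
  by apply: continuousM => //; exact: cst_continuous.
have dF s : is_derive s 1 F (pexp n s * (A + B * s - C * expR (- k * s))).
  have d1 := is_derive_pexp n s; have d2 := is_derive_pexp n.+1 s.
  have d3 := is_derive_texp n k s.
  apply: is_derive_eq; rewrite /GRing.scale/=.
  rewrite -[B * _ * _]mulrA -mulr_pexp.
  by field; rewrite expf_neq0.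
rewrite (integral_primitive z0 cf dF); congr EFin; rewrite /F !fctE/= /GRing.scale/=.
by rewrite !pexpS0 texp0; ring.
Qed.

End exp_primitives.

(** * Integration over the height [z] *)

Section outer_integrals.
Variable R : realType.
Local Notation mu := (@lebesgue_measure R).

Lemma integral_primitive_oc (f F : R -> R) :
  continuous f -> (forall x : R, is_derive x 1 F (f x)) ->
  (\int[mu]_(x in `]0%R, 1%R]) (f x)%:E = (F 1 - F 0)%:E)%E.
Proof.
move=> cf dF; rewrite integral_itv_obnd_cbnd; first exact: integral_primitive.
by apply/measurable_EFinP/measurable_funTS; exact: continuous_measurable_fun.
Qed.

Lemma integral_pexp_oc n (k : R) :
  (\int[mu]_(z in `]0%R, 1%R]) (k * pexp n z)%:E = (k / n.+1`!%:R)%:E)%E.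
Proof.
have cf : continuous (fun z => k * pexp n z).
  by move=> z; apply: continuousM; [exact: cst_continuous|exact: continuous_pexp].
have dF (z : R) : is_derive z 1 (k \*: @pexp R n.+1) (k * pexp n z).
  by have d1 := is_derive_pexp n z; exact: is_derive_eq.
rewrite (integral_primitive_oc cf dF) /= pexpS0 scaler0 subr0.
by rewrite /pexp expr1n mul1r.
Qed.

(* The last summand has, up to the factor [- u ^- n.+1], the integrand
   [expR (al * z) - expR ((al - u) * z) * exp_partial n.+1 (u * z)]; the
   derivatives of both [texp] terms of its primitive contribute a multiple of
   [expR ((al - u) * z) * pexp n z], and these cancel. *)
Lemma integral_naive_outer n (A B K al u w : R) :
  al != 0 -> u != 0 -> w != 0 -> w = u - al ->
  (\int[mu]_(z in `]0%R, 1%R]) (K * ((z * A + 1) * pexp n.+1 z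
     + B * n.+1%:R * pexp n.+2 z
     + expR (al * z) / u ^+ n.+1 * (texp n.+1 u z - 1)))%:E =
   (K * ((A * n.+2%:R + B * n.+1%:R) / n.+3`!%:R + 1 / n.+2`!%:R
     - (expR al * (1 - texp n.+1 u 1) / (al * u ^+ n.+1)
        - (1 - texp n.+1 w 1) / (al * w ^+ n.+1))))%:E)%E.
Proof.
move=> al0 u0 w0 wE.
pose f (z : R) := K * ((z * A + 1) * pexp n.+1 z + B * n.+1%:R * pexp n.+2 z
     + expR (al * z) / u ^+ n.+1 * (texp n.+1 u z - 1)).
(* Integration by parts of [expR (al * z)] against [texp n.+1 u z - 1] gives the first [texp] term;
   the remaining integrand [expR (- w * z) * pexp n z] gives the second. *)
pose F := K \*: (((A * n.+2%:R + B * n.+1%:R) \*: @pexp R n.+3 + @pexp R n.+2)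
  - ((al * u ^+ n.+1)^-1 \*: ((fun z => expR (al * z)) * (cst 1 - texp n.+1 u))
     - (al * w ^+ n.+1)^-1 \*: (cst 1 - texp n.+1 w))).
have cf : continuous f.
  move=> z; apply: cvgM; first exact: cvg_cst.
  apply: cvgD; last first.
    apply: cvgM; last by apply: cvgB; [exact: continuous_texp|exact: cvg_cst].
    by apply: cvgM; [exact: continuous_expRM|exact: cvg_cst].
  apply: cvgD; apply: cvgM; [|exact: continuous_pexp| |exact: continuous_pexp].
    by apply: cvgD; [apply: cvgM; [exact: cvg_id|]|]; exact: cvg_cst.
  exact: cvg_cst.
have dF (z : R) : is_derive z 1 F (f z).
  have d1 := is_derive_pexp n.+1 z; have d2 := is_derive_pexp n.+2 z.
  have d3 := is_derive_texp n u z; have d4 := is_derive_texp n w z.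
  have d5 := is_derive_expRM al z.
  apply: is_derive_eq; rewrite /f /GRing.scale/= !fctE/=.
  have -> : expR (- w * z) = expR (al * z) * expR (- u * z).
    by rewrite -expRD wE; congr expR; ring.
  have -> : (z * A + 1) * pexp n.+1 z = A * (n.+2%:R * pexp n.+2 z) + pexp n.+1 z.
    by rewrite -mulr_pexp; ring.
  have : u ^+ n.+1 != 0 by rewrite expf_neq0.
  have : w ^+ n.+1 != 0 by rewrite expf_neq0.
  move: (u ^+ n.+1) (w ^+ n.+1) (n.+2%:R : R) (n.+1%:R : R) => U W N2 N1 W0 U0.
  by field; rewrite al0 U0 W0.
apply: etrans (integral_primitive_oc cf dF) _; congr EFin.
rewrite /F /GRing.scale/= !fctE/= !pexpS0 !texp0 [al * 0]mulr0 expR0 [al * 1]mulr1.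
by rewrite /pexp !expr1n /GRing.scale/=; ring.
Qed.

End outer_integrals.

(** * The two relaxations *)

Section closure.
Variable R : realType.

(** If [h p < 0], then [h] is negative on a neighbourhood of [p], which must meet [A]. Continuity is
    asked at [p] alone because the perspective is singular at [z = 0]. *)
Lemma closure_ge0 (T : topologicalType) (A : set T) (h : T -> R) (p : T) :
  {for p, continuous h} -> (forall q, A q -> 0 <= h q) -> closure A p -> 0 <= h p.
Proof.
move=> ch A0 Ap; rewrite leNgt; apply/negP => hp0.
have /Ap[q [Aq /= hq]] : nbhs p (h @^-1` [set x | x < 0]).
  by apply: ch; exact: lt_nbhsl.
by have := A0 _ Aq; rewrite leNgt hq.
Qed.

Lemma continuous_at_sum (T : topologicalType) (I : finType) (F : I -> T -> R) (p : T) :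
  (forall i, {for p, continuous (F i)}) ->
  {for p, continuous (fun q => \sum_i F i q)}.
Proof.
move=> cF; suff : (\sum_i F i q) @[q --> p] --> \sum_i F i p by [].
have addc : continuous (fun x : R * R => x.1 + x.2) by exact: add_continuous.
by apply: (cvg_big addc) => i _; exact: cF.
Qed.

Lemma continuous_at_mulmx (T : topologicalType) m n (f : T -> 'rV[R]_m)
    (A : 'M[R]_(m, n)) (p : T) (j : 'I_n) :
  (forall i, {for p, continuous (fun q => f q ord0 i)}) ->
  {for p, continuous (fun q => (f q *m A) ord0 j)}.
Proof.
move=> cf.
have -> : (fun q => (f q *m A) ord0 j) = (fun q => \sum_i f q ord0 i * A i j).
  by apply/funext => q; rewrite mxE.
apply: continuous_at_sum => i; apply: cvgM; [exact: cf|exact: cvg_cst].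
Qed.

Lemma continuous_at_dotr (T : topologicalType) n (c : 'rV[R]_n) (f : T -> 'rV[R]_n)
    (p : T) :
  (forall i, {for p, continuous (fun q => f q ord0 i)}) ->
  {for p, continuous (fun q => dotr c (f q))}.
Proof.
move=> cf; apply: continuous_at_sum => i.
by apply: cvgM; [exact: cvg_cst|exact: cf].
Qed.

Variables (n : nat) (v : 'I_n.+2 -> 'rV[R]_n.+1).
Hypothesis vindep : aff_indep v.
Variables (c a : 'rV[R]_n.+1) (b : R).
Let f := fun x : 'rV[R]_n.+1 => expR (dotr c x) - 1.

(** The closure adds points only at [z = 0]: elsewhere every constraint is a weak inequality between
    functions continuous at the point, with membership in [z J] expressed through [bary]. The strict
    [0 < z] survives as [0 <= z] together with [z != 0]. *)
Lemma persp_relaxP x y z : z != 0 -> persp_relax f a b (conv_hull v) (x, y, z) <->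
  [/\ 0 < z <= 1, scale_set z (conv_hull v) x
    & z * f (z^-1 *: x) <= y <= dotr a x + b * z].
Proof.
move=> z0; split; last first.
  by move=> [z01 Jx /andP[fy ym]]; apply: subset_closure; do !split.
rewrite /persp_relax; set A := (X in closure X) => clA.
pose p : 'rV[R]_n.+1 * R * R := (x, y, z).
have cx i : {for p, continuous (fun q : 'rV[R]_n.+1 * R * R => q.1.1 ord0 i)}.
  apply: (@continuous_comp _ _ _ (fun q : 'rV[R]_n.+1 * R * R => q.1.1)
    (fun w : 'rV[R]_n.+1 => w ord0 i)); last exact: coord_continuous.
  by apply: (@continuous_comp _ _ _ fst fst); exact: cvg_fst.
have cy : {for p, continuous (fun q : 'rV[R]_n.+1 * R * R => q.1.2)}.
  by apply: (@continuous_comp _ _ _ fst snd); [exact: cvg_fst|exact: cvg_snd].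
have cz : {for p, continuous (fun q : 'rV[R]_n.+1 * R * R => q.2)}.
  exact: cvg_snd.
have AE q : A q -> [/\ 0 < q.2, q.2 <= 1, scale_set q.2 (conv_hull v) q.1.1,
    q.2 * f (q.2^-1 *: q.1.1) <= q.1.2 & q.1.2 <= dotr a q.1.1 + b * q.2].
  by case: q => -[x' y'] z' /= [? [? [? /andP[]]]].
have cb i : {for p, continuous (fun q : 'rV[R]_n.+1 * R * R =>
    bary v q.1.1 q.2 ord0 i)}.
  apply: continuous_at_mulmx => j.
  have -> : (fun q : 'rV[R]_n.+1 * R * R => (q.1.1 - q.2 *: v ord0) ord0 j) =
      (fun q => q.1.1 ord0 j - q.2 * v ord0 ord0 j).
    by apply/funext => q; rewrite !mxE.
  by apply: cvgB; [exact: cx|apply: cvgM; [exact: cz|exact: cvg_cst]].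
have z_ge0 : 0 <= z by apply: (closure_ge0 cz _ clA) => q /AE[/ltW].
have z_gt0 : 0 < z by rewrite lt_neqAle eq_sym z0.
have z_le1 : 0 <= 1 - z.
  apply: (@closure_ge0 _ A (fun q => 1 - q.2) p _ _ clA) => [|q /AE[_ ? _ _ _]].
    by apply: cvgB; [exact: cvg_cst|exact: cz].
  by rewrite subr_ge0.
split.
- by rewrite z_gt0 -subr_ge0.
- apply/scale_conv_hull_bary => //; apply/andP; split.
    apply/forallP => i; apply: (closure_ge0 (cb i) _ clA) => q /AE[q0 _ Jq _ _].
    by have /scale_conv_hull_bary - /(_ vindep q0)/andP[/forallP] := Jq.
  rewrite -subr_ge0.
  apply: (@closure_ge0 _ A (fun q => q.2 - vsum (bary v q.1.1 q.2)) p _ _ clA).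
    by apply: cvgB; [exact: cz|exact: continuous_at_sum].
  move=> q /AE[q0 _ Jq _ _]; rewrite subr_ge0.
  by have /scale_conv_hull_bary - /(_ vindep q0)/andP[] := Jq.
- apply/andP; split; rewrite -subr_ge0.
    apply: (@closure_ge0 _ A
      (fun q => q.1.2 - q.2 * f (q.2^-1 *: q.1.1)) p _ _ clA); last first.
      by move=> q /AE[_ _ _ ? _]; rewrite subr_ge0.
    apply: cvgB; first exact: cy.
    apply: cvgM; first exact: cz.
    apply: cvgB; last exact: cvg_cst.
    apply: (@continuous_comp _ _ _
      (fun q : 'rV[R]_n.+1 * R * R => dotr c (q.2^-1 *: q.1.1)) expR);
      last exact: continuous_expR.
    apply: continuous_at_dotr => i.
    have -> : (fun q : 'rV[R]_n.+1 * R * R => (q.2^-1 *: q.1.1) ord0 i) =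
        (fun q => q.2^-1 * q.1.1 ord0 i) by apply/funext => q; rewrite mxE.
    (* Continuity of the inverse at [z] rests on [z != 0]. *)
    by apply: cvgM; [apply: cvgV; [exact: z0|exact: cz]|exact: cx].
  apply: (@closure_ge0 _ A
    (fun q => dotr a q.1.1 + b * q.2 - q.1.2) p _ _ clA); last first.
    by move=> q /AE[_ _ _ _ ?]; rewrite subr_ge0.
  apply: cvgB; last exact: cy.
  apply: cvgD.
    exact: (@continuous_at_dotr _ _ a (fun q : 'rV[R]_n.+1 * R * R => q.1.1) p cx).
  by apply: cvgM; [exact: cvg_cst|exact: cz].
Qed.

Lemma naive_relaxP x y z : z != 0 -> naive_relax f a b (conv_hull v) (x, y, z) <->
  [/\ 0 < z <= 1, scale_set z (conv_hull v) x & f x <= y <= dotr a x + b * z].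
Proof.
move=> z0; split=> [[ym [fy [Jx /andP[zge0 z1]]]]|[/andP[zgt0 z1] Jx /andP[fy ym]]].
  by split => //; [rewrite lt_neqAle eq_sym z0 zge0|rewrite fy].
by do !split => //; rewrite ltW.
Qed.

End closure.

Lemma measurable_inv (R : realType) : measurable_fun [set: R] (@GRing.inv R).
Proof.
have mexpln : measurable_fun setT (fun z : R => expR (- ln z)).
  apply: measurableT_comp => //; exact: measurable_funN.
(* On each open half-line the inverse is an exponential of a logarithm; the last branch is the
   convention that 0 has inverse 0. *)
rewrite (_ : @GRing.inv R = fun z => if 0 < z then expR (- ln z) else
    if z < 0 then - expR (- ln (- z)) else 0).
  apply: measurable_fun_ifT => //; first exact: measurable_fun_ltr.
  apply: measurable_fun_ifT => //; first exact: measurable_fun_ltr.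
  by apply: measurable_funN; exact: (measurableT_comp mexpln).
apply/funext => z; case: ltgtP => [z0|z0|<-]; last by rewrite invr0.
  by rewrite expRN lnK.
by rewrite expRN lnK ?invrN ?opprK// posrE oppr_gt0.
Qed.

(** * Volumes of the two relaxations *)

Section relaxation_volumes.
Variables (R : realType) (n : nat) (v : 'I_n.+2 -> 'rV[R]_n.+1).
Variables (c a : 'rV[R]_n.+1) (u b : R).
Hypothesis vindep : aff_indep v.
Hypothesis u0 : u != 0.
Hypothesis cu : forall j, j != ord0 -> dotr c (v ord0) - dotr c (v j) = u.
Hypothesis agree : forall i, dotr a (v i) + b = expR (dotr c (v i)) - 1.

Let al := dotr c (v ord0).
Let f := fun x : 'rV[R]_n.+1 => expR (dotr c x) - 1.
Let U := expR al - expR (al - u).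
Let m (x : 'rV[R]_n.+1) (z : R) := dotr a x + b * z.
Let M (z s : R) := z * (expR al - 1) - U * s.

(** Agreement at the vertices makes [a] drop by [U] along every edge from [v ord0], as [c] drops by
    [u], so [dotr_edge] applies to [a] as well. *)
Let mM lam z : m (lam *m edge_mx v + z *: v ord0) z = M z (vsum lam).
Proof.
rewrite /m (@dotr_edge _ _ _ a _ U) => [|j j0].
  have -> : b = expR al - 1 - dotr a (v ord0) by rewrite -(agree ord0); ring.
  by rewrite /M; ring.
have -> : dotr a (v ord0) - dotr a (v j)
    = (dotr a (v ord0) + b) - (dotr a (v j) + b) by ring.
rewrite !agree /U; have -> : dotr c (v j) = al - u by rewrite /al -(cu j0); ring.
by rewrite -/al; ring.
Qed.

Let measurable_m : measurable_fun setT (fun p : 'rV[R]_n.+1 * R => m p.1 p.2).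
Proof.
apply: measurable_funD; last exact: measurable_funM.
exact: (measurableT_comp (@measurable_dotr _ _ _)).
Qed.

Let measurable_M z : measurable_fun setT (M z).
Proof. by apply: measurable_funB => //; exact: measurable_funM. Qed.

(** Convexity of the exponential between [al] and [al - u] with weight [s / z], multiplied by
    [z]. *)
Let persp_le (z s : R) : 0 < z <= 1 -> 0 <= s <= z ->
  z * (expR (z^-1 * (z * al - u * s)) - 1) <= M z s.
Proof.
move=> /andP[z0 z1] /andP[s0 sz].
have zn : z != 0 by rewrite gt_eqF.
have t01 : 0 <= s / z <= 1 by rewrite divr_ge0 ?(ltW z0)//= ler_pdivrMr// mul1r.
have := expR_convex al (al - u) t01.
have -> : (1 - s / z) * al + s / z * (al - u) = z^-1 * (z * al - u * s) by field.
move=> /(ler_wpM2l (ltW z0)) H.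
rewrite mulrBr mulr1 /M /U; apply: le_trans (lerB H (lexx z)) _.
by rewrite le_eqVlt; apply/orP; left; apply/eqP; field.
Qed.

(** Since [f] vanishes at 0, convexity with weight [z] gives [f x <= z * f (z^-1 *: x)]: the naive
    lower bound lies below the perspective one. *)
Let naive_le (z s : R) : 0 < z <= 1 -> 0 <= s <= z ->
  expR (z * al - u * s) - 1 <= M z s.
Proof.
move=> z01 sz; apply: le_trans (persp_le z01 sz); move/andP: z01 => [z0 z1].
have zn : z != 0 by rewrite gt_eqF.
have := @expR_convex _ z 0 (z^-1 * (z * al - u * s)).
rewrite (ltW z0) z1 mulr0 add0r mulrA divff// mul1r expR0 => /(_ isT) H.
rewrite lerBlDr; apply: le_trans H _.
by rewrite le_eqVlt; apply/orP; left; apply/eqP; ring.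
Qed.

Variable K : R.
Hypothesis HK : simplex_jacobian v K.

Local Open Scope ereal_scope.

(** The relaxation is a truncated cone, so its slice at height [z] scales as the power [n.+2] of
    [z]: the inner integral is a constant times [pexp n.+2 z]. *)
Lemma vol3_persp : vol3 (persp_relax f a b (conv_hull v)) =
  (K * (expR al * n.+2%:R - U * n.+1%:R
        + expR al / u ^+ n.+1 * (texp n.+1 u 1 - 1) * n.+2`!%:R)
     / n.+3`!%:R)%:E.
Proof.
pose l (x : 'rV[R]_n.+1) (z : R) := (z * f (z^-1 *: x))%R.
pose L (z s : R) := (z * (expR (z^-1 * (z * al - u * s)) - 1))%R.
rewrite (@vol3_region _ _ _ vindep _ HK _ l m L M)//; last 4 first.
- by move=> x y z; exact: persp_relaxP.
- apply: measurable_funM => //; apply: measurable_funB => //.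
  apply: measurableT_comp => //; under eq_fun do rewrite dotrZ.
  apply: measurable_funM; first exact: (measurableT_comp (@measurable_inv R)).
  exact: (measurableT_comp (@measurable_dotr _ _ _)).
- by move=> lam z z0; rewrite /l /f dotrZ (dotr_edge _ _ cu).
- move=> z; apply: measurable_funM => //; apply: measurable_funB => //.
  apply: measurableT_comp => //; apply: measurable_funM => //.
  by apply: measurable_funB => //; exact: measurable_funM.
rewrite -[RHS]integral_pexp_oc; apply: eq_integral => z.
rewrite inE/= in_itv/= => /andP[z0 z1].
have zn : z != 0%R by rewrite gt_eqF.
have uz : (u / z)%R != 0%R by rewrite mulf_neq0 ?invr_neq0.
under eq_integral => s _.
  have -> : (M z s - L z s = z * expR al + (- U) * s
      - z * expR al * expR (- (u / z) * s))%R.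
    rewrite /M /L (_ : z^-1 * (z * al - u * s) = al + - (u / z) * s)%R; last by field.
    by rewrite expRD; ring.
  over.
rewrite (integral_pexp_expR _ _ _ _ uz (ltW z0)) -EFinM; congr EFin.
(* [texp] depends only on the product of rate and argument, so the rate [u / z] evaluated at [z]
   gives a constant. *)
have -> : texp n.+1 (u / z) z = texp n.+1 u 1.
  by rewrite /texp !mulr1 mulNr divfK.
rewrite -[RHS]mulrA; congr (_ * _)%R.
have -> : (z * expR al * pexp n.+1 z = expR al * n.+2%:R * pexp n.+2 z)%R.
  by rewrite -[RHS]mulrA -mulr_pexp; ring.
have -> : (z * expR al / (u / z) ^+ n.+1 =
    expR al / u ^+ n.+1 * n.+2`!%:R * pexp n.+2 z)%R.
  rewrite /pexp expr_div_n (exprS z n.+1).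
  have := fact_neq0 R n.+2; have := expf_neq0 n.+1 zn; have := expf_neq0 n.+1 u0.
  move: (u ^+ n.+1)%R (z ^+ n.+1)%R (n.+2`!%:R)%R => X Y Z X0 Y0 Z0.
  by field; rewrite X0 Y0 Z0.
ring.
Qed.

(** The exponential rate in [s] is [u] at every height, so the inner integral keeps [texp n.+1 u z],
    multiplied by [expR (al * z)]; [integral_naive_outer] integrates this product. *)
Lemma vol3_naive (w : R) : w = (u - al)%R -> al != 0%R -> w != 0%R ->
  vol3 (naive_relax f a b (conv_hull v)) =
  (K * (((expR al - 1) * n.+2%:R + (- U) * n.+1%:R) / n.+3`!%:R + 1 / n.+2`!%:R
     - (expR al * (1 - texp n.+1 u 1) / (al * u ^+ n.+1)
        - (1 - texp n.+1 w 1) / (al * w ^+ n.+1))))%:E.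
Proof.
move=> wE al0 w0.
pose l (x : 'rV[R]_n.+1) (z : R) := f x.
pose L (z s : R) := (expR (z * al - u * s) - 1)%R.
rewrite (@vol3_region _ _ _ vindep _ HK _ l m L M)//; last 4 first.
- by move=> x y z; exact: naive_relaxP.
- apply: measurable_funB => //; apply: measurableT_comp => //.
  exact: (measurableT_comp (@measurable_dotr _ _ _)).
- by move=> lam z z0; rewrite /l /f (dotr_edge _ _ cu).
- move=> z; apply: measurable_funB => //; apply: measurableT_comp => //.
  by apply: measurable_funB => //; exact: measurable_funM.
rewrite -integral_naive_outer//; apply: eq_integral => z.
rewrite inE/= in_itv/= => /andP[z0 z1].
under eq_integral => s _.
  have -> : (M z s - L z s = (z * (expR al - 1) + 1) + (- U) * s
      - expR (al * z) * expR (- u * s))%R.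
    rewrite /M /L (_ : z * al - u * s = al * z + - u * s)%R; last by ring.
    by rewrite expRD; ring.
  over.
by rewrite (integral_pexp_expR _ _ _ _ u0 (ltW z0)) -EFinM.
Qed.

End relaxation_volumes.

Theorem theorem13 (R : realType) (d : nat) (v : 'I_d.+1 -> 'rV[R]_d)
  (c : 'rV[R]_d) (u : R) (a : 'rV[R]_d) (b : R) :
  aff_indep v ->
  (forall x, conv_hull v x -> (forall i, 0 <= x ord0 i) /\ x != 0) ->
  u != 0 ->
  (forall j : 'I_d.+1, j != ord0 -> dotr c (v ord0) - dotr c (v j) = u) ->
  (* mu(x) = a^T x + b is the affine function agreeing with f at the vertices *)
  (forall i, dotr a (v i) + b = expR (dotr c (v i)) - 1) ->
  let f := fun x : 'rV[R]_d => expR (dotr c x) - 1 in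
  let J := conv_hull v in
  let cv0 := dotr c (v ord0) in
  let S := fun w : R => \sum_(j < d) w ^+ j / (j`!)%:R in
  let w := - (cv0 - u) in
  (vol3 (persp_relax f a b J) =
    ((d`!)%:R / ((d + 2)`!)%:R * (expR cv0 + d%:R * expR (cv0 - u)))%:E * vol J
    - ((d`!)%:R / (d + 2)%:R * (expR (cv0 - u) / u ^+ d * (expR u - S u)))%:E
        * vol J)%E
  /\
  ((cv0 != 0)%R -> (w != 0)%R ->
   vol3 (naive_relax f a b J) =
     ((d`!)%:R / ((d + 2)`!)%:R * (expR cv0 + d%:R * expR (cv0 - u) + 1))%:E
        * vol J
     - ((d`!)%:R * (expR (cv0 - u) / (cv0 * u ^+ d) * (expR u - S u)))%:E
        * vol J
     + ((d`!)%:R * (expR (cv0 - u) / (cv0 * w ^+ d) * (expR w - S w)))%:E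
        * vol J)%E.
Proof.
case: d v c a => [|n] v c a vindep Jpos u0 cu agree f J cv0 S w.
  (* In dimension 0 the only vector is the origin, which [Jpos] excludes from the simplex. *)
  have : conv_hull v (v ord0).
    exists (fun=> 1); do !split => //; first by rewrite big_ord1.
    by rewrite big_ord1 scale1r.
  by move=> /Jpos[_ /eqP[]]; apply/rowP => -[].
have [K K0 HK] := simplex_jacobian_ex vindep.
have volJ : vol J = (K / (n.+1)`!%:R)%:E by exact: vol_simplex.
(* Every exponential is reduced to [expR cv0] and [expR (- u)], and every factorial to that of
   [n.+1], leaving identities between rational functions. *)
have Xu : expR (cv0 - u) = expR cv0 * expR (- u) by rewrite expRD.
have Yu : expR u = (expR (- u))^-1 by rewrite -expRN opprK.
have X0 : expR (- u) != 0 by rewrite gt_eqF ?expR_gt0.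
have un0 : u ^+ n.+1 != 0 by rewrite expf_neq0.
have F0 := fact_neq0 R n.+1.
have N2 : n.+2%:R = n.+1%:R + 1 :> R by rewrite -natr1.
have N3 : n.+3%:R = n.+1%:R + 2 :> R by rewrite -addn2 natrD.
have N10 : n.+1%:R + 1 != 0 :> R by rewrite -N2 pnatr_eq0.
have N20 : n.+1%:R + 2 != 0 :> R by rewrite -N3 pnatr_eq0.
have texp1 k : texp n.+1 k 1 = expR (- k) * S k by rewrite /texp !mulr1.
have factE3 : n.+3`!%:R = (n.+1%:R + 2) * ((n.+1%:R + 1) * n.+1`!%:R) :> R.
  by rewrite 2!factS !natrM N2 N3.
have factE2 : n.+2`!%:R = (n.+1%:R + 1) * n.+1`!%:R :> R.
  by rewrite factS natrM N2.
split.
  rewrite (vol3_persp vindep u0 cu agree HK) volJ -!EFinM -EFinB; congr EFin.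
  rewrite -/cv0 addn2 texp1 Xu Yu N2 N3 factE3 factE2.
  move: X0 F0 N10 N20 un0.
  move: (expR (- u)) (n.+1`!%:R : R) (n.+1%:R : R) (u ^+ n.+1) (S u) => X F N V Su.
  by move=> *; field; do ?[apply/andP; split].
move=> cv00 w0; have wE : w = u - cv0 by rewrite /w opprB.
(* As [w = u - cv0], the factor [expR (cv0 - u)] of the statement cancels against [expR w]. *)
have Xw : expR cv0 * expR (- u) = expR (- w).
  by rewrite -expRD wE; congr expR; ring.
have Yw : expR w = (expR (- w))^-1 by rewrite -expRN opprK.
have W0 : expR (- w) != 0 by rewrite gt_eqF ?expR_gt0.
have wn0 : w ^+ n.+1 != 0 by rewrite expf_neq0.
rewrite (vol3_naive vindep u0 cu agree HK wE)// volJ -!EFinM -EFinB -EFinD; congr EFin.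
rewrite -/cv0 addn2 !texp1 Xu Yu Yw -Xw N2 factE3 factE2.
rewrite -Xw in W0.
move: X0 F0 N10 N20 un0 wn0 cv00 W0.
have : expR cv0 != 0 by rewrite gt_eqF ?expR_gt0.
move: (expR (- u)) (n.+1`!%:R : R) (n.+1%:R : R) (u ^+ n.+1) (S u) (w ^+ n.+1) (S w).
move=> X F N V Su W Sw.
move: (expR cv0) => ea.
by move=> *; field; do ?[apply/andP; split].
Qed.
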